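(* Let $n,t$ be positive integers with $t$ even. Let $G$ be a graph with vertex set $[n]$, and let $X_1,\ldots,X_n$ be random variables (on a common probability space) that take values in $[0,1]$ and $t$-agree with $G$. Let $X = \sum_{i \in [n]} X_i$ and let $\mu = \mathbb{E}[X]$. Then, for every real $a > 0$, $$\mathbb{P}\left[\,|X-\mu| \geq a\,\right] < 2\sqrt{\pi t}\cdot\left(\frac{\sqrt{n\, t\cdot \chi(G)}}{a}\right)^t.$$
   Context: Notation: $[n]=\{1,\ldots,n\}$. All graphs are simple and undirected; a graph of size $n$ has $n$ vertices, and its vertex set $V(G)$ is identified with $[n]$, so that vertex $i$ represents the random variable $X_i$. A set $S\subseteq V(G)$ is an independent set of vertices if no two vertices in $S$ are joined by an edge of $G$. The chromatic number $\chi(G)$ is the smallest integer $k$ for which there is a map $V(G)\to[k]$ sending any two adjacent vertices to different integers. $t$-wise independence: random variables $Y_1,\ldots,Y_m$ are $t$-wise independent if for every $T\subseteq[m]$ of size $t$ the set of variables $\{Y_i : i\in T\}$ is (mutually) independent. $t$-agree: random variables $X_1,\ldots,X_n$ $t$-agree with the graph $G$ if for every independent set of vertices $S\subseteq V(G)$, the set of variables $\{X_i : i\in S\}$ is $t$-wise independent. *)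

(* Defs.v *)
From HB Require Import structures.
From mathcomp Require Import all_boot all_order all_algebra.
From mathcomp Require Import all_classical all_reals all_analysis.

Set Implicit Arguments.
Unset Strict Implicit.
Unset Printing Implicit Defensive.

Import Order.TTheory GRing.Theory Num.Theory.

(* The vertices 1, ..., n are shifted to 0, ..., n.-1. *)
Record sgraph (n : nat) := SGraph {
  edge :> rel 'I_n;
  edge_sym : symmetric edge;
  edge_irr : irreflexive edge }.

Section Graph.
Variables (n : nat) (G : sgraph n).

Definition independent_set (S : {set 'I_n}) : bool :=
  [forall i in S, forall j in S, ~~ G i j].

Definition colorable (k : nat) : bool :=
  [exists c : {ffun 'I_n -> 'I_k}, forall i, forall j, G i j ==> (c i != c j)].

Lemma colorable_exists : exists k, colorable k.
Proof.
exists n; apply/existsP; exists [ffun i => i].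
apply/forallP => i; apply/forallP => j; apply/implyP => Gij.
by rewrite !ffunE; apply: contraTneq Gij => ->; rewrite edge_irr.
Qed.

Definition chromatic_number : nat := ex_minn colorable_exists.

End Graph.

Local Open Scope classical_set_scope.
Local Open Scope ereal_scope.

Section Independence.
Context {d : measure_display} {Omega : measurableType d} {R : realType}.
Variables (P : probability Omega R) (I : finType) (X : I -> {RV P >-> R}).

Definition mutually_independent (A : {set I}) : Prop :=
  forall (J : {set I}) (B : I -> set R),
    J \subset A -> (forall i, measurable (B i)) ->
    P (\bigcap_(i in [set` J]) (X i @^-1` B i)) =
    \prod_(i in J) P (X i @^-1` B i).

(* Vacuous when A has fewer than t elements: only the subsets of size exactly
   t are constrained. *)
Definition twise_independent (t : nat) (A : {set I}) : Prop :=
  forall T : {set I}, T \subset A -> #|T| = t -> mutually_independent T.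

End Independence.

Definition t_agree d (Omega : measurableType d) (R : realType)
    (P : probability Omega R) (n : nat) (t : nat) (G : sgraph n)
    (X : 'I_n -> {RV P >-> R}) : Prop :=
  forall S : {set 'I_n}, independent_set G S -> twise_independent X t S.

(* Main.v *)
Require Import Defs.
From HB Require Import structures.
From mathcomp Require Import all_boot all_order all_algebra.
From mathcomp Require Import all_classical all_reals all_analysis.
From mathcomp Require Import measurable_realfun ring lra zify.

Set Implicit Arguments.
Unset Strict Implicit.
Unset Printing Implicit Defensive.

Import Order.TTheory GRing.Theory Num.Theory.
Local Open Scope classical_set_scope.
Local Open Scope ring_scope.

(** Independence is only available inside an independent set of vertices, so
the sum is split along an optimal colouring with k = chi(G) classes, and
Markov's inequality is applied to the t-th power of the deviation.  Write
t = 2h and let Y_i = X_i - E X_i.  The bound proved for the moment is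
E (sum_i Y_i)^t <= (n t k)^h; it is multiplied by 2 sqrt(pi t) > 1 in the
theorem, which makes the inequality strict.

For one class of s vertices the claim is E (sum_i Y_i)^t <= (s t)^h
([centered_sum_moment_le]).  A class with s < t carries no independence
assumption, but there the deviation is at most s <= sqrt(s t) pointwise.  If
s >= t, every monomial of degree t in the Y_i involves at most t variables, so
its expectation factors into moments
([Ex_monomial_of_twise_independent]).  The moments E Y_i^j have absolute
values at most 1, 0, 1/4, 1/4, ..., because Y_i is centered, bounded by 1 and of variance at
most 1/4.  The t-th moment of the sum is therefore at most t! times the
coefficient of y^t in the s-th power of 1 + (1/4) sum_(j >= 2) y^j / j!.  For
0 < y <= 1 that series is at most 1 + y^2/4, hence the moment is at most
t! y^-t (1 + y^2/4)^s ([mixed_moment_le]), and y^2 = t/s gives (s t)^h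
([moment_numeric_bound]).

The classes are put together without any independence between them.  If D_c is
the deviation of class c and n_c its size, Cauchy-Schwarz gives
(sum_c D_c)^2 <= k sum_c D_c^2 = k sum_i V_i, where the sum over the vertices i
has terms V_i = D_c^2 / n_c for c the colour of i.  Since E V_i^h <= t^h, the
power mean inequality over the n vertices yields (n t k)^h
([colored_sum_moment_le]).

Mutual independence is given by a product rule for events.  It extends to
expectations of products by exchanging indicators for bounded functions one
factor at a time ([Ex_prod_of_mutually_independent]); a single exchange holds
by uniform approximation of a function with values in [0, 1] by averages of
indicators of half-lines. *)

(** * Expectations of bounded random variables *)

Section BoundedExpectation.
Context {d : measure_display} {Omega : measurableType d} {R : realType}.
Variable P : probability Omega R.
Implicit Types f g : Omega -> R.

(** All the variables below are bounded, and this class is closed under sums and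
products; it spares the integrability side conditions. *)
Definition bounded_rv f :=
  measurable_fun setT f /\ exists M : R, forall w, `|f w| <= M.

Local Notation Ex f := (Rintegral P setT f).

Lemma bounded_rv_cst (r : R) : bounded_rv (fun=> r).
Proof. by split; [exact: measurable_cst | exists `|r|]. Qed.

Lemma bounded_rvD f g :
  bounded_rv f -> bounded_rv g -> bounded_rv (fun w => f w + g w).
Proof.
move=> [mf [M Mf]] [mg [N Ng]]; split; first exact: measurable_funD.
by exists (M + N) => w; rewrite (le_trans (ler_normD _ _)) ?lerD.
Qed.

Lemma bounded_rvM f g :
  bounded_rv f -> bounded_rv g -> bounded_rv (fun w => f w * g w).
Proof.
move=> [mf [M Mf]] [mg [N Ng]]; split; first exact: measurable_funM.
by exists (M * N) => w; rewrite normrM ler_pM.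
Qed.

Lemma bounded_rvX f m : bounded_rv f -> bounded_rv (fun w => f w ^+ m).
Proof.
move=> bf; elim: m => [|m IHm].
  by under eq_fun do rewrite expr0; exact: bounded_rv_cst.
by under eq_fun do rewrite exprS; exact: bounded_rvM.
Qed.

Lemma bounded_rv_sum (I : Type) (s : seq I) (p : pred I) (F : I -> Omega -> R) :
  (forall i, bounded_rv (F i)) -> bounded_rv (fun w => \sum_(i <- s | p i) F i w).
Proof.
move=> bF; elim: s => [|i s IHs].
  by under eq_fun do rewrite big_nil; exact: bounded_rv_cst.
by under eq_fun do rewrite big_cons; case: (p i) => //; exact: bounded_rvD.
Qed.

Lemma bounded_rv_prod (I : Type) (s : seq I) (p : pred I) (F : I -> Omega -> R) :
  (forall i, bounded_rv (F i)) -> bounded_rv (fun w => \prod_(i <- s | p i) F i w).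
Proof.
move=> bF; elim: s => [|i s IHs].
  by under eq_fun do rewrite big_nil; exact: bounded_rv_cst.
by under eq_fun do rewrite big_cons; case: (p i) => //; exact: bounded_rvM.
Qed.

Lemma bounded_rv_norm f : bounded_rv f -> bounded_rv (fun w => `|f w|).
Proof.
move=> [mf [M Mf]]; split; first exact: measurableT_comp.
by exists M => w; rewrite normr_id.
Qed.

Lemma bounded_rv_integrable f :
  bounded_rv f -> P.-integrable setT (EFin \o f).
Proof.
move=> [mf [M Mf]]; apply: measurable_bounded_integrable => //.
  by rewrite ltey_eq fin_num_measure.
exists M; split; first by rewrite num_real.
by move=> x Mx w _; exact: le_trans (Mf w) (ltW Mx).
Qed.

Lemma Ex_cst (r : R) : Ex (fun=> r) = r.
Proof.
rewrite Rintegral_cst// -[RHS]mulr1 -[X in _ = _ * X]/(fine 1%E).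
by congr (_ * fine _); exact: probability_setT.
Qed.

Lemma ExD f g : bounded_rv f -> bounded_rv g ->
  Ex (fun w => f w + g w) = Ex f + Ex g.
Proof. by move=> bf bg; apply: RintegralD => //; exact: bounded_rv_integrable. Qed.

Lemma ExZ f (r : R) : bounded_rv f -> Ex (fun w => r * f w) = r * Ex f.
Proof. by move=> bf; apply: RintegralZl => //; exact: bounded_rv_integrable. Qed.

Lemma Ex_sum (I : Type) (s : seq I) (p : pred I) (F : I -> Omega -> R) :
  (forall i, bounded_rv (F i)) ->
  Ex (fun w => \sum_(i <- s | p i) F i w) = \sum_(i <- s | p i) Ex (F i).
Proof.
move=> bF; elim: s => [|i s IHs].
  by under eq_fun do rewrite big_nil; rewrite Ex_cst big_nil.
under eq_fun do rewrite big_cons; rewrite big_cons; case: (p i) => //.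
by rewrite ExD ?IHs//; exact: bounded_rv_sum.
Qed.

Lemma le_Ex f g : bounded_rv f -> bounded_rv g -> (forall w, f w <= g w) ->
  Ex f <= Ex g.
Proof.
by move=> bf bg fg; apply: le_Rintegral => //; exact: bounded_rv_integrable.
Qed.

Lemma ler_norm_Ex f : bounded_rv f -> `|Ex f| <= Ex (fun w => `|f w|).
Proof.
by move=> bf; apply: le_normr_Rintegral => //; exact: bounded_rv_integrable.
Qed.

Lemma Ex_indic (A : set Omega) : measurable A -> Ex (\1_A) = fine (P A).
Proof. by move=> mA; rewrite /Rintegral integral_indic// setIT. Qed.

Lemma bounded_rv_indic (A : set Omega) : measurable A -> bounded_rv (\1_A).
Proof.
move=> mA; split; first exact: measurable_indic.
by exists 1 => w; rewrite indicE; case: (_ \in _); rewrite ?normr1 ?normr0.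
Qed.

(** Markov's inequality for the power h.*2; evenness lets f be used in place of
its absolute value. *)
Lemma markov_even_moment f (h : nat) (a : R) : bounded_rv f -> 0 < a ->
  (P [set w | a <= `|f w|]%R <= (Ex (fun w => f w ^+ h.*2) / a ^+ h.*2)%:E)%E.
Proof.
move=> bf a0; set A := [set w | _].
have mA : measurable A.
  have [mf _] := bounded_rv_norm bf.
  rewrite (_ : A = (fun w => `|f w|) @^-1` `[a, +oo[).
    by rewrite -[X in measurable X]setTI; exact: mf.
  by apply/seteqP; split => w /=; rewrite in_itv/= andbT.
rewrite -[P A]fineK ?fin_num_measure// lee_fin ler_pdivlMr ?exprn_gt0//.
rewrite mulrC -Ex_indic// -ExZ; last exact: bounded_rv_indic.
apply: le_Ex => [||w].
- by apply: bounded_rvM; [exact: bounded_rv_cst|exact: bounded_rv_indic].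
- exact: bounded_rvX.
rewrite indicE; have [/set_mem wA|_] := boolP (w \in A); last first.
  by rewrite mulr0 -mul2n exprM exprn_ge0// sqr_ge0.
rewrite mulr1 -[f w ^+ _]ger0_norm; last by rewrite -mul2n exprM exprn_ge0// sqr_ge0.
by rewrite normrX lerXn2r// nnegrE ?normr_ge0// ltW.
Qed.

End BoundedExpectation.

(** * Independence and expectations of products *)

Section IndependentProducts.
Context {d : measure_display} {Omega : measurableType d} {R : realType}.
Variable P : probability Omega R.

Local Notation Ex f := (Rintegral P setT f).

(** The number of k in 1, ..., N.+1 with k <= (N.+1) x is the integer part of
(N.+1) x. *)
Lemma threshold_count_approx (N : nat) (x : R) : 0 <= x <= 1 ->
  `|x - N.+1%:R^-1 * \sum_(k < N.+1) \1_(`[k.+1%:R / N.+1%:R, +oo[) x|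
  <= N.+1%:R^-1.
Proof.
move=> /andP[x0 x1]; set c : R := N.+1%:R.
have c0 : 0 < c by rewrite ltr0n.
have cx0 : 0 <= x * c by rewrite mulr_ge0// ltW.
have /andP[lej ltj] := truncn_itv cx0; set j := Num.truncn _ in lej ltj.
have jN : (j <= N.+1)%N.
  by rewrite -(ler_nat R) (le_trans lej)// ler_piMl// ltW.
have -> : \sum_(k < N.+1) \1_(`[k.+1%:R / c, +oo[) x = j%:R :> R.
  under eq_bigr => k _.
    rewrite indicE mem_setE in_itv/= andbT ler_pdivrMr// -truncn_gt_nat -/j.
    over.
  rewrite -natr_sum; congr (_%:R).
  rewrite -[RHS]muln1 -[X in _ = (X * _)%N]card_ord -sum_nat_const.
  rewrite (big_ord_widen N.+1 (fun=> 1%N) jN) [RHS]big_mkcond/=.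
  by apply: eq_bigr => k _; case: (k < j)%N.
rewrite -(ler_pM2r c0) mulVf ?gt_eqF// -[X in _ * X]gtr0_norm// -normrM.
rewrite mulrBl mulrAC mulVf ?gt_eqF// mul1r ger0_norm ?subr_ge0//.
by rewrite lerBlDl -natr1 in ltj *; rewrite ltW.
Qed.

(** Both sides are linear in Z, and the hypothesis gives equality when Z is
replaced by its threshold approximation; the error made is O(1/N).  The constant
c, which is E W (take B = setT), is kept abstract because in the application it
comes as a product of expectations. *)
Lemma uncorrelated_of_indicators_unit (Z W : Omega -> R) (c : R) :
  measurable_fun setT Z -> (forall w, 0 <= Z w <= 1) -> bounded_rv W ->
  (forall B : set R, measurable B ->
     Ex (fun w => \1_B (Z w) * W w) = Ex (fun w => \1_B (Z w)) * c) ->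
  Ex (fun w => Z w * W w) = Ex Z * c.
Proof.
move=> mZ Z01 bW indW.
have bZ : bounded_rv Z.
  by split => //; exists 1 => w; have /andP[? ?] := Z01 w; rewrite ger0_norm.
have [_ [M WM]] := bW.
have M0 : 0 <= M by exact: le_trans (normr_ge0 _) (WM point).
have bI (B : set R) : measurable B -> bounded_rv (fun w => \1_B (Z w) : R).
  move=> mB; split; last first.
    by exists 1 => w; rewrite indicE; case: (_ \in _); rewrite ?normr1 ?normr0.
  by apply: measurableT_comp => //; exact: measurable_indic.
suff approx N : `|Ex (fun w => Z w * W w) - Ex Z * c| <= (M + `|c|) / N.+1%:R.
  apply/eqP; rewrite -subr_eq0 -normr_le0 leNgt; apply/negP => gt0.
  set e := `| _ | in gt0 approx.
  have := approx (Num.truncn ((M + `|c|) / e)).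
  rewrite ler_pdivlMr ?ltr0n// mulrC -ler_pdivlMr// leNgt.
  by rewrite truncnS_gt.
pose ZN w := N.+1%:R^-1 * \sum_(k < N.+1) \1_(`[k.+1%:R / N.+1%:R, +oo[) (Z w) : R.
have bS : bounded_rv
    (fun w => \sum_(k < N.+1) \1_(`[k.+1%:R / N.+1%:R, +oo[) (Z w) : R).
  by apply: bounded_rv_sum => k; apply: bI.
have bZN : bounded_rv ZN by apply: bounded_rvM => //; exact: bounded_rv_cst.
have ZNW : Ex (fun w => ZN w * W w) = Ex ZN * c.
  rewrite /ZN ExZ// Ex_sum => [|k]; last exact: bI.
  under eq_fun do rewrite -mulrA mulr_suml.
  rewrite ExZ; last first.
    by apply: bounded_rv_sum => k; apply: bounded_rvM => //; apply: bI.
  rewrite Ex_sum => [|k]; last by apply: bounded_rvM => //; apply: bI.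
  rewrite -mulrA mulr_suml; congr (_ * _).
  by apply: eq_bigr => k _; rewrite indW.
have bD : bounded_rv (fun w => Z w - ZN w).
  apply: bounded_rvD => //; under eq_fun do rewrite -mulN1r.
  by apply: bounded_rvM => //; exact: bounded_rv_cst.
have Dle w : `|Z w - ZN w| <= N.+1%:R^-1 by exact: threshold_count_approx.
have ZE : Ex Z = Ex (fun w => Z w - ZN w) + Ex ZN.
  by rewrite -ExD//; congr Rintegral; apply/funext => w; rewrite subrK.
have ZWE : Ex (fun w => Z w * W w) =
    Ex (fun w => (Z w - ZN w) * W w) + Ex (fun w => ZN w * W w).
  rewrite -(ExD P (bounded_rvM bD bW) (bounded_rvM bZN bW)).
  by congr Rintegral; apply/funext => w; rewrite -mulrDl subrK.
rewrite ZWE ZNW ZE mulrDl opprD addrACA subrr addr0 mulrDl.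
rewrite (le_trans (ler_normB _ _))// lerD//.
  rewrite (le_trans (ler_norm_Ex P (bounded_rvM bD bW)))//.
  rewrite -[leRHS](Ex_cst P) le_Ex//.
  - exact: bounded_rv_norm (bounded_rvM bD bW).
  - exact: bounded_rv_cst.
  - by move=> w; rewrite normrM mulrC ler_pM.
rewrite normrM mulrC ler_wpM2l//.
rewrite (le_trans (ler_norm_Ex P bD))// -[leRHS](Ex_cst P) le_Ex//.
- exact: bounded_rv_norm.
- exact: bounded_rv_cst.
Qed.

(** An affine change of variable brings g (Z w) into [0, 1]. *)
Lemma uncorrelated_of_indicators (Z W : Omega -> R) (c : R) (g : R -> R) :
  measurable_fun setT Z -> bounded_rv W ->
  (forall B : set R, measurable B ->
     Ex (fun w => \1_B (Z w) * W w) = Ex (fun w => \1_B (Z w)) * c) ->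
  measurable_fun setT g -> bounded_rv (fun w => g (Z w)) ->
  Ex (fun w => g (Z w) * W w) = Ex (fun w => g (Z w)) * c.
Proof.
move=> mZ bW indW mg bg; have [_ [M gM]] := bg.
have M0 : 0 <= M by exact: le_trans (normr_ge0 _) (gM point).
pose b : R := M + 1.
have b0 : 0 < 2 * b by rewrite /b; lra.
pose u w := (2 * b)^-1 * (g (Z w) + b).
have bgb : bounded_rv (fun w => g (Z w) + b).
  by apply: bounded_rvD => //; exact: bounded_rv_cst.
have mu : measurable_fun setT u.
  by have [] : bounded_rv u by apply: bounded_rvM => //; exact: bounded_rv_cst.
have mh : measurable_fun setT (fun x => (2 * b)^-1 * (g x + b)).
  by apply: measurable_funM => //; apply: measurable_funD.
have u01 w : 0 <= u w <= 1.
  have := gM w; rewrite ler_norml /b => /andP[gl gu].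
  rewrite /u; apply/andP; split; last by rewrite ler_pdivrMl// mulr1 /b; lra.
  by rewrite mulr_ge0 ?invr_ge0 ?ltW// /b; lra.
have indU (B : set R) : measurable B ->
    Ex (fun w => \1_B (u w) * W w) = Ex (fun w => \1_B (u w)) * c.
  move=> mB; have := indW ((fun x => (2 * b)^-1 * (g x + b)) @^-1` B).
  rewrite -[X in measurable X]setTI; apply.
  exact: mh.
have EW : Ex W = c.
  have := indW setT measurableT.
  under eq_fun do rewrite indicT mul1r.
  by under [in RHS]eq_fun do rewrite indicT; rewrite Ex_cst mul1r.
have bgW := bounded_rvM bg bW.
have bcW := bounded_rvM (bounded_rv_cst b) bW.
have := uncorrelated_of_indicators_unit mu u01 bW indU.
have -> : (fun w => u w * W w) =
    (fun w => (2 * b)^-1 * (g (Z w) * W w + b * W w)).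
  by apply/funext => w; rewrite /u; ring.
rewrite (ExZ P _ (bounded_rvD bgW bcW)) (ExD P bgW bcW) (ExZ P b bW) EW.
rewrite (ExZ P _ bgb) (ExD P bg (bounded_rv_cst b)) Ex_cst -mulrA.
have b0' : (2 * b)^-1 != 0 by rewrite invr_neq0// gt_eqF.
by move=> /(mulfI b0'); rewrite [(_ + b) * c]mulrDl; apply: addIr.
Qed.

Variables (I : finType) (X : I -> {RV P >-> R}).

(** By induction on the list s of the indices whose factor is not yet known to be
an indicator: with s empty this is the product rule for events, and one more
arbitrary factor is allowed by [uncorrelated_of_indicators]. *)
Lemma Ex_prod_of_mutually_independent (A J : {set I}) (g : I -> R -> R) :
  mutually_independent X A -> J \subset A ->
  (forall i, measurable_fun setT (g i)) ->
  (forall i, bounded_rv (fun w => g i (X i w))) ->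
  Ex (fun w => \prod_(i in J) g i (X i w)) =
  \prod_(i in J) Ex (fun w => g i (X i w)).
Proof.
move=> indX JA mg bg.
suff H (s : seq I) : forall h : I -> R -> R,
    (forall i, measurable_fun setT (h i)) ->
    (forall i, bounded_rv (fun w => h i (X i w))) ->
    (forall i, i \in J -> i \notin s ->
       exists2 B : set R, measurable B & h i = \1_B) ->
    Ex (fun w => \prod_(i in J) h i (X i w)) =
    \prod_(i in J) Ex (fun w => h i (X i w)).
  by apply: (H (enum J)) => // i; rewrite mem_enum => ->.
elim: s => [|i s IHs] h mh bh hind.
  have /choice[B BP] : forall i, exists B : set R,
      measurable B /\ (i \in J -> h i = \1_B).
    move=> i; have [iJ|iJ] := boolP (i \in J); last by exists setT.
    by have [B mB hB] := hind i iJ isT; exists B.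
  have mXB i : measurable (X i @^-1` B i).
    by rewrite -[X in measurable X]setTI; apply: measurable_funPT => //; case: (BP i).
  transitivity (Ex \1_(\bigcap_(i in [set` J]) (X i @^-1` B i))).
    congr Rintegral; apply/funext => w; rewrite indicE.
    have [/set_mem wB|wB] := boolP (w \in _).
      apply: big1 => i iJ; have [_ ->//] := BP i.
      by rewrite indicE mem_set//; exact: wB.
    have [i iJ wBi] : exists2 i, i \in J & ~ B i (X i w).
      apply: contrapT => nex; case/negP: wB; apply/mem_set => i /= iJ.
      by apply: contrapT => nB; apply: nex; exists i.
    rewrite (bigD1 i)//=; have [_ ->//] := BP i.
    by rewrite indicE memNset// mul0r.
  rewrite Ex_indic; last first.
    by apply: fin_bigcap_measurable => //; exact: finite_finset.
  rewrite indX//; last by move=> i; case: (BP i).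
  transitivity (fine (\prod_(i in J) Ex (fun w => h i (X i w)))%:E) => //.
  congr fine.
  rewrite -prodEFin; apply: eq_bigr => i iJ.
  rewrite -[LHS]fineK ?fin_num_measure// -Ex_indic//; congr (Rintegral _ _ _)%:E.
  by apply/funext => w; have [_ ->] := BP i.
have [iJ|iJ] := boolP (i \in J); last first.
  apply: IHs => // j jJ js; apply: hind => //; rewrite inE negb_or js andbT.
  by apply: contraNneq iJ => <-.
have splitJ (k : I -> R -> R) :
    (fun w => \prod_(j in J) k j (X j w)) =
    (fun w => k i (X i w) * \prod_(j in J | j != i) k j (X j w)).
  by apply/funext => w; rewrite (bigD1 i).
rewrite splitJ (bigD1 i)//=.
apply: uncorrelated_of_indicators => //; first exact: bounded_rv_prod.
move=> B mB.
pose h' j := if j == i then \1_B else h j.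
have h'i : h' i = \1_B by rewrite /h' eqxx.
have h'j j : j != i -> h' j = h j by rewrite /h' => /negPf ->.
have -> : (fun w => \1_B (X i w) * \prod_(j in J | j != i) h j (X j w)) =
    (fun w => \prod_(j in J) h' j (X j w)).
  apply/funext => w; rewrite [RHS](bigD1 i)//= h'i; congr (_ * _).
  by apply: eq_bigr => j /andP[_ /h'j ->].
transitivity (\prod_(j in J) Ex (fun w => h' j (X j w))); last first.
  rewrite (bigD1 i)//= h'i; congr (_ * _).
  by apply: eq_bigr => j /andP[_ /h'j ->].
apply: IHs => [j|j|j jJ js].
- by rewrite /h'; case: ifP => // _; exact: measurable_indic.
- rewrite /h'; case: eqP => // ->; split.
    by apply: measurableT_comp => //; exact: measurable_indic.
  by exists 1 => w; rewrite indicE; case: (_ \in _); rewrite ?normr1 ?normr0.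
- rewrite /h'; case: ifP => [_|/negbT ji]; first by exists B.
  by apply: hind => //; rewrite inE negb_or ji.
Qed.

End IndependentProducts.

(** * Moments of a sum whose monomials factor *)

Section MomentMajorant.
Context {d : measure_display} {Omega : measurableType d} {R : realType}.
Variables (P : probability Omega R) (I : finType).

Local Notation Ex f := (Rintegral P setT f).

(** The sum over s is expanded one variable at a time, and the variables already
expanded are recorded by the exponents k.  With x the sum over the remaining
variables, the binomial term 'C(m, j) x^(m-j) Y_i^j contributes
'C(m, j) (m-j)! y^-(m-j) beta_j = (m! y^-m) (beta_j y^j / j!), and summing over
j gives one factor q: this is the product of exponential generating functions,
with only its value at one point y kept.  Only monomials of degree at most t
are ever factored. *)
Lemma mixed_moment_le (A : {set I}) (t : nat) (Y : I -> Omega -> R)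
    (beta : nat -> R) (y q : R) :
  (forall i, bounded_rv (Y i)) ->
  (forall k : I -> nat, (\sum_(i in A) k i <= t)%N ->
     Ex (fun w => \prod_(i in A) Y i w ^+ k i) =
     \prod_(i in A) Ex (fun w => Y i w ^+ k i)) ->
  (forall i k, `|Ex (fun w => Y i w ^+ k)| <= beta k) ->
  beta 0%N = 1 -> 0 < y ->
  (forall N : nat, \sum_(j < N) beta j * y ^+ j / j`!%:R <= q) ->
  forall (s : seq I) (k : I -> nat) (m : nat),
    uniq s -> {subset s <= A} -> {in s, forall i, k i = 0%N} ->
    (m + \sum_(i in A) k i <= t)%N ->
    `|Ex (fun w => (\sum_(i <- s) Y i w) ^+ m * \prod_(i in A) Y i w ^+ k i)|
    <= m`!%:R / y ^+ m * q ^+ size s * \prod_(i in A) beta (k i).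
Proof.
move=> bY factor Ybeta beta0 y0 hq.
have beta_ge0 k : I -> 0 <= beta k by move=> i; exact: le_trans (Ybeta i k).
have bP (k : I -> nat) : bounded_rv (fun w => \prod_(i in A) Y i w ^+ k i).
  by apply: bounded_rv_prod => i; exact: bounded_rvX.
elim=> [|i s IHs] k m.
  move=> _ _ _ kt; case: m kt => [|m] kt; last first.
    under eq_fun do rewrite big_nil exprS !mul0r.
    rewrite Ex_cst normr0 expr0 mulr1 mulr_ge0//.
      by rewrite divr_ge0// exprn_ge0// ltW.
    by apply: prodr_ge0 => i _; exact: beta_ge0.
  under eq_fun do rewrite expr0 mul1r.
  rewrite factor// fact0 !expr0 divr1 !mul1r normr_prod.
  by apply: ler_prod => i _; rewrite normr_ge0 Ybeta.
move=> /= /andP[nis us] sA k0 kt.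
have iA : i \in A by apply: sA; rewrite mem_head.
have sA' : {subset s <= A} by move=> j js; apply: sA; rewrite inE js orbT.
have ki0 : k i = 0%N by rewrite k0 ?mem_head.
pose k' (j : nat) l := if l == i then j else k l.
have k'E j l : l != i -> k' j l = k l by rewrite /k' => /negPf ->.
have k'i j : k' j i = j by rewrite /k' eqxx.
have sumk j : (\sum_(l in A) k' j l = j + \sum_(l in A) k l)%N.
  rewrite (bigD1 i)//= [in RHS](bigD1 i)//= k'i ki0 add0n; congr (_ + _)%N.
  by apply: eq_bigr => l /andP[_ /k'E ->].
have prodY j w : \prod_(l in A) Y l w ^+ k' j l =
    Y i w ^+ j * \prod_(l in A) Y l w ^+ k l.
  rewrite (bigD1 i)//= [in RHS](bigD1 i)//= k'i ki0 expr0 mul1r; congr (_ * _).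
  by apply: eq_bigr => l /andP[_ /k'E ->].
have prodb j : \prod_(l in A) beta (k' j l) =
    beta j * \prod_(l in A) beta (k l).
  rewrite (bigD1 i)//= [in RHS](bigD1 i)//= k'i ki0 beta0 mul1r; congr (_ * _).
  by apply: eq_bigr => l /andP[_ /k'E ->].
pose F j w := (\sum_(l <- s) Y l w) ^+ (m - j) * \prod_(l in A) Y l w ^+ k' j l.
have bF j : bounded_rv (F j).
  by apply: bounded_rvM => //; apply: bounded_rvX; exact: bounded_rv_sum.
have -> : (fun w => (\sum_(l <- i :: s) Y l w) ^+ m * \prod_(l in A) Y l w ^+ k l)
    = (fun w => \sum_(j < m.+1) 'C(m, j)%:R * F j w).
  apply/funext => w; rewrite big_cons addrC exprDn mulr_suml.
  by apply: eq_bigr => j _; rewrite /F prodY mulr_natl mulrnAl mulrA.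
rewrite Ex_sum => [|j]; last first.
  by apply: bounded_rvM => //; exact: bounded_rv_cst.
rewrite (le_trans (ler_norm_sum _ _ _))//.
set Q := q ^+ size s; set B := \prod_(l in A) beta (k l).
have B0 : 0 <= B by apply: prodr_ge0 => l _; exact: beta_ge0.
have q0 : 0 <= q by have := hq 0%N; rewrite big_ord0.
have mfy : 0 <= m`!%:R / y ^+ m by rewrite divr_ge0// exprn_ge0// ltW.
apply: (@le_trans _ _ (\sum_(j < m.+1)
    (m`!%:R / y ^+ m * Q * B) * (beta j * y ^+ j / j`!%:R))).
  apply: ler_sum => j _.
  have jm : (j <= m)%N by rewrite -ltnS.
  rewrite (ExZ P _ (bF j)) normrM normr_nat.
  have IH : `|Ex (F j)| <= (m - j)`!%:R / y ^+ (m - j) * Q * (beta j * B).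
    rewrite /B -prodb; apply: IHs => //.
      by move=> l ls; rewrite k'E ?k0 ?inE ?ls ?orbT//; apply: contraNneq nis => <-.
    by rewrite sumk addnA subnK.
  apply: le_trans (ler_wpM2l _ IH) _ => //.
  have y_neq0 : y != 0 by rewrite gt_eqF.
  rewrite -(bin_fact jm) !natrM.
  have -> : y ^+ m = y ^+ (m - j) * y ^+ j by rewrite -exprD subnK.
  have fj0 : j`!%:R != 0 :> R by rewrite pnatr_eq0 -lt0n fact_gt0.
  rewrite le_eqVlt; apply/orP; left; apply/eqP; field.
  by rewrite fj0 !expf_neq0.
rewrite -mulr_sumr (le_trans (ler_wpM2l _ (hq m.+1)))//.
  by rewrite mulr_ge0// mulr_ge0// exprn_ge0.
by rewrite exprSr !mulrA [X in X <= _]mulrAC.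
Qed.

End MomentMajorant.

Section Numerics.
Variable R : realType.

(** The sum telescopes against 1 - 1/(N.+1)!, since 2/(N.+2)! <= 1/(N.+1)!. *)
Lemma sum_inv_fact_le1 (N : nat) : \sum_(j < N) (j.+2`!%:R : R)^-1 <= 1.
Proof.
suff H : \sum_(j < N) (j.+2`!%:R : R)^-1 <= 1 - N.+1`!%:R^-1.
  by rewrite (le_trans H)// gerBl invr_ge0.
elim: N => [|N IHN]; first by rewrite big_ord0 (_ : 1`! = 1%N)// invr1 subrr.
rewrite big_ord_recr/= (le_trans (lerD IHN (lexx _)))//.
have a0 : 0 <= N.+1`!%:R^-1 :> R by rewrite invr_ge0.
have b2 : N.+2%:R^-1 <= 2^-1 :> R by rewrite lef_pV2 ?posrE ?ltr0n// ler_nat.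
rewrite (factS N.+1) natrM invfM.
by move: (_^-1) (N.+2%:R^-1) a0 b2 => a b a0 b2; nra.
Qed.

(** Bounds for the absolute values of the moments of a centered variable of
variance at most 1/4 with values in [-1, 1]: from the second moment on, the
variance is a bound. *)
Definition centered_moment_majorant (k : nat) : R :=
  match k with 0 => 1 | 1 => 0 | _ => 4^-1 end.

Lemma centered_majorant_egf_le (y : R) (N : nat) : 0 < y <= 1 ->
  \sum_(j < N) centered_moment_majorant j * y ^+ j / j`!%:R <= 1 + y ^+ 2 / 4.
Proof.
move=> /andP[y0 y1].
have y2 : 0 <= y ^+ 2 / 4 by rewrite divr_ge0// exprn_ge0// ltW.
case: N => [|[|N]].
- by rewrite big_ord0 addr_ge0.
- by rewrite big_ord1 expr0 fact0 divr1 mulr1 lerDl.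
rewrite 2!big_ord_recl/= expr0 fact0 divr1 mulr1 !mul0r add0r lerD2l.
have H (j : 'I_N) : 4^-1 * y ^+ j.+2 / j.+2`!%:R <= y ^+ 2 / 4 * (j.+2`!%:R)^-1.
  rewrite ler_wpM2r ?invr_ge0// mulrC ler_wpM2r//.
  by rewrite -addn2 exprD ler_piMl ?exprn_ge0 ?exprn_ile1// ltW.
apply: le_trans (ler_sum _ (fun j _ => H j)) _.
by rewrite -mulr_sumr ler_piMr// sum_inv_fact_le1.
Qed.

(** Bernoulli's inequality (1 + 2/a)^k >= 1 + 2k/a without denominators. *)
Lemma expnD2_bernoulli (a k : nat) : (a ^ k * (a + 2 * k) <= a * (a + 2) ^ k)%N.
Proof.
elim: k => [|k IHk]; first by rewrite !expn0; lia.
have ak : (a ^ k <= (a + 2) ^ k)%N by case: (k) => // l; rewrite leq_exp2r ?leq_addr.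
rewrite !expnS; nia.
Qed.

(** The step from n = 2h to n + 2 multiplies the left side by 2(n + 1)(n + 2),
which is at most 2(n + 2)^2, and the right side by (n + 2)^2 times
(n + 2)^n / n^n >= 2. *)
Lemma fact_double_le (h : nat) : (h.*2`! * 2 ^ h <= h.*2 ^ h.*2)%N.
Proof.
elim: h => // -[//|h] IHh.
set n := h.+1.*2 in IHh *.
have bern : (2 * n ^ n <= (n + 2) ^ n)%N.
  have := expnD2_bernoulli n n.
  have n0 : (0 < n)%N by [].
  have -> : (n ^ n * (n + 2 * n) = n * (3 * n ^ n))%N by ring.
  by rewrite leq_pmul2l// => /(leq_trans _); apply; rewrite leq_mul2r orbT.
have fa : (n`! * 2 ^ h.+2 <= (n + 2) ^ n)%N.
  by apply: leq_trans bern; rewrite expnS mulnCA leq_mul2l IHh orbT.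
have -> : (h.+2.*2`! * 2 ^ h.+2 = n.+2 * n.+1 * (n`! * 2 ^ h.+2))%N.
  by rewrite (factS n.+1) (factS n) !mulnA.
have -> : (h.+2.*2 ^ h.+2.*2 = n.+2 * n.+2 * (n + 2) ^ n)%N.
  by rewrite addn2 !expnS mulnA.
by rewrite leq_mul// leq_mul.
Qed.

(** This evaluates t! y^-t (1 + y^2/4)^s at y^2 = t/s, with t = h.*2: the last
factor is at most exp(t/4) = exp(1/2)^h <= 2^h, and t! 2^h <= t^t. *)
Lemma moment_numeric_bound (s h : nat) : (0 < h)%N -> (h.*2 <= s)%N ->
  h.*2`!%:R / Num.sqrt (h.*2%:R / s%:R) ^+ h.*2
    * (1 + Num.sqrt (h.*2%:R / s%:R) ^+ 2 / 4) ^+ s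
  <= (s%:R * h.*2%:R) ^+ h :> R.
Proof.
move=> h0 hs; set t : R := h.*2%:R.
have t0 : 0 < t by rewrite ltr0n double_gt0.
have s0 : 0 < s%:R :> R by rewrite ltr0n (leq_trans _ hs)// double_gt0.
have r0 : 0 <= t / s%:R by rewrite ltW// divr_gt0.
rewrite -{1}[X in _ ^+ X]mul2n exprM sqr_sqrtr//.
have expo : (1 + t / s%:R / 4) ^+ s <= 2 ^+ h :> R.
  have half : expR (2^-1) <= 2 :> R.
    (* exp(1/2) = 1 / exp(-1/2) and exp(-1/2) >= 1 - 1/2 *)
    rewrite -[2^-1]opprK expRN -lef_pV2 ?posrE ?invr_gt0 ?expR_gt0// invrK.
    by apply: le_trans (expR_ge1Dx _); lra.
  apply: (@le_trans _ _ (expR (t / s%:R / 4) ^+ s)).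
    by rewrite lerXn2r ?nnegrE ?expR_ge0 ?expR_ge1Dx// addr_ge0// divr_ge0.
  rewrite -expRM_natr.
  have -> : t / s%:R / 4 * s%:R = 2^-1 * h%:R.
    by rewrite /t -mul2n natrM; field; rewrite gt_eqF.
  by rewrite expRM_natr lerXn2r ?nnegrE ?expR_ge0//.
have fle : h.*2`!%:R * 2 ^+ h <= t ^+ h.*2.
  by rewrite /t -!natrX -natrM ler_nat fact_double_le.
apply: le_trans (ler_wpM2l _ expo) _; first by rewrite divr_ge0// exprn_ge0.
rewrite mulrAC ler_pdivrMr ?exprn_gt0 ?divr_gt0// (le_trans fle)//.
rewrite -exprMn -mul2n exprM le_eqVlt; apply/orP; left; apply/eqP.
by congr (_ ^+ _); field; rewrite gt_eqF.
Qed.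

End Numerics.

(** * Sums of t-wise independent variables *)

Section TwiseIndependentMoment.
Context {d : measure_display} {Omega : measurableType d} {R : realType}.
Variables (P : probability Omega R) (I : finType) (X : I -> {RV P >-> R}).
Hypothesis X01 : forall i w, 0 <= X i w <= 1.

Local Notation Ex f := (Rintegral P setT f).

Definition centered i w : R := X i w - Ex (X i).

Lemma bounded_rv_unit i : bounded_rv (X i).
Proof.
split; first exact: measurable_funPT.
by exists 1 => w; have /andP[? ?] := X01 i w; rewrite ger0_norm.
Qed.

Lemma bounded_rv_centered i : bounded_rv (centered i).
Proof. by apply: bounded_rvD; [exact: bounded_rv_unit|exact: bounded_rv_cst]. Qed.

Lemma Ex_unit_bounds i : 0 <= Ex (X i) <= 1.
Proof.
have b := bounded_rv_unit i; apply/andP; split.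
  by apply: Rintegral_ge0 => w _; have /andP[] := X01 i w.
rewrite -(Ex_cst P 1); apply: le_Ex => //; first exact: bounded_rv_cst.
by move=> w; have /andP[] := X01 i w.
Qed.

Lemma norm_centered_le1 i w : `|centered i w| <= 1.
Proof.
have /andP[? ?] := X01 i w; have /andP[? ?] := Ex_unit_bounds i.
by rewrite ler_norml /centered; lra.
Qed.

Lemma Ex_centered i : Ex (centered i) = 0.
Proof.
rewrite /centered (ExD P (bounded_rv_unit i) (bounded_rv_cst _)) Ex_cst.
by rewrite subrr.
Qed.

(** Since X^2 <= X on [0, 1], the variance is at most m - m^2 with m = E X. *)
Lemma variance_unit_le i : Ex (fun w => centered i w ^+ 2) <= 4^-1.
Proof.
set m := Ex (X i).
have bX := bounded_rv_unit i.
have bcX := bounded_rvM (bounded_rv_cst (1 - 2 * m)) bX.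
have b1 := bounded_rvD bcX (bounded_rv_cst (m ^+ 2)).
apply: (@le_trans _ _ (Ex (fun w => (1 - 2 * m) * X i w + m ^+ 2))).
  apply: le_Ex => //; first exact: bounded_rvX (bounded_rv_centered i).
  by move=> w; have /andP[? ?] := X01 i w; rewrite /centered -/m; nra.
rewrite (ExD P bcX (bounded_rv_cst _)) (ExZ P _ bX) Ex_cst -/m.
by have := sqr_ge0 (m - 2^-1); nra.
Qed.

Lemma centered_moment_le i k :
  `|Ex (fun w => centered i w ^+ k)| <= centered_moment_majorant R k.
Proof.
case: k => [|[|k]] /=.
- by under eq_fun do rewrite expr0; rewrite Ex_cst normr1.
- by under eq_fun do rewrite expr1; rewrite Ex_centered normr0.
have b := bounded_rv_centered i.
apply: le_trans (variance_unit_le i).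
apply: le_trans (ler_norm_Ex P (bounded_rvX k.+2 b)) _.
apply: le_Ex => [||w].
- exact: bounded_rv_norm (bounded_rvX _ b).
- exact: bounded_rvX.
rewrite normrX -[leRHS]ger0_norm ?sqr_ge0// normrX -addn2 exprD.
by rewrite ler_piMl ?exprn_ge0// exprn_ile1// norm_centered_le1.
Qed.

Lemma exists_subset_of_card (A J : {set I}) (t : nat) :
  J \subset A -> (#|J| <= t <= #|A|)%N ->
  exists2 T : {set I}, J \subset T & T \subset A /\ #|T| = t.
Proof.
move=> JA; elim: t => [|t IHt] /andP[Jt tA].
  by exists J => //; split => //; apply/eqP; rewrite -leqn0.
move: Jt; rewrite leq_eqVlt => /predU1P[Jt|Jt].
  by exists J.
have [|T JT [TA Tt]] := IHt; first by rewrite -ltnS Jt ltnW.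
have /fintype.subsetPn[x xA xT] : ~~ (A \subset T).
  by apply: contraTN tA => /subset_leq_card; rewrite Tt -ltnNge.
exists (x |: T); first by rewrite subsetU// JT orbT.
by rewrite finset.subUset finset.sub1set xA TA cardsU1 xT Tt.
Qed.

(** The indices of nonzero exponent are at most t in number, so they lie in a
set of size exactly t, to which t-wise independence applies; this is where
t <= #|A| is needed. *)
Lemma Ex_monomial_of_twise_independent (A : {set I}) (t : nat) (k : I -> nat) :
  twise_independent X t A -> (t <= #|A|)%N -> (\sum_(i in A) k i <= t)%N ->
  Ex (fun w => \prod_(i in A) centered i w ^+ k i) =
  \prod_(i in A) Ex (fun w => centered i w ^+ k i).
Proof.
move=> indX tA kt; pose J := [set i in A | (0 < k i)%N].
have JA : J \subset A by apply/fintype.subsetP => i; rewrite inE => /andP[].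
have Jt : (#|J| <= t)%N.
  apply: leq_trans kt; rewrite -sum1_card [leqRHS](big_setID J)/=.
  rewrite (finset.setIidPr JA) (leq_trans _ (leq_addr _ _))// leq_sum// => i.
  by rewrite inE => /andP[].
have k0 i : i \in A -> i \notin J -> k i = 0%N.
  by move=> iA; rewrite inE iA/= -eqn0Ngt => /eqP.
have [T JT [TA Tt]] := exists_subset_of_card JA (introT andP (conj Jt tA)).
have restrict (F : I -> R) : (forall i, k i = 0%N -> F i = 1) ->
    \prod_(i in A) F i = \prod_(i in J) F i.
  move=> F1; rewrite (big_setID J)/= (finset.setIidPr JA) [X in _ * X]big1 ?mulr1//.
  by move=> i; rewrite inE => /andP[iJ iA]; rewrite F1// k0.
rewrite restrict => [|i ->]; last first.
  by under eq_fun do rewrite expr0; rewrite Ex_cst.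
have -> : (fun w => \prod_(i in A) centered i w ^+ k i) =
    (fun w => \prod_(i in J) centered i w ^+ k i).
  by apply/funext => w; apply: restrict => i ->; rewrite expr0.
apply: (Ex_prod_of_mutually_independent (indX T TA Tt) JT
         (g := fun i x => (x - Ex (X i)) ^+ k i)) => i.
  by apply: measurable_funX; apply: measurable_funB.
exact: bounded_rvX (bounded_rv_centered i).
Qed.

(** For #|A| < t, where t-wise independence says nothing, the sum is bounded
pointwise by #|A|, and #|A|^2 <= #|A| t. *)
Lemma centered_sum_moment_le (A : {set I}) (h : nat) : (0 < h)%N ->
  twise_independent X h.*2 A ->
  Ex (fun w => (\sum_(i in A) centered i w) ^+ h.*2)
  <= (#|A|%:R * h.*2%:R) ^+ h.
Proof.
move=> h0 indX.
have bS : bounded_rv (fun w => \sum_(i in A) centered i w).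
  by apply: bounded_rv_sum => i; exact: bounded_rv_centered.
have [tA|At] := leqP h.*2 #|A|; last first.
  rewrite -(Ex_cst P ((#|A|%:R * h.*2%:R) ^+ h)); apply: le_Ex => [||w].
  - exact: bounded_rvX.
  - exact: bounded_rv_cst.
  rewrite -[h.*2 in leLHS]mul2n exprM lerXn2r ?nnegrE ?sqr_ge0 ?mulr_ge0//.
  have SA : `|\sum_(i in A) centered i w| <= #|A|%:R.
    rewrite (le_trans (ler_norm_sum _ _ _))// -sumr_const ler_sum// => i _.
    exact: norm_centered_le1.
  rewrite -[leLHS]ger0_norm ?sqr_ge0// normrX expr2 ler_pM//.
  by rewrite (le_trans SA)// ler_nat ltnW.
apply: le_trans (moment_numeric_bound R h0 tA).
set y := Num.sqrt _.
have A0 : 0 < #|A|%:R :> R by rewrite ltr0n (leq_trans _ tA)// double_gt0.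
have y0 : 0 < y by rewrite sqrtr_gt0 divr_gt0// ltr0n double_gt0.
have y1 : y <= 1.
  by rewrite -[leRHS]sqrtr1 ler_wsqrtr// ler_pdivrMr// mul1r ler_nat.
have := @mixed_moment_le _ _ _ P I A h.*2 centered (centered_moment_majorant R)
  y (1 + y ^+ 2 / 4) bounded_rv_centered
  (fun k => Ex_monomial_of_twise_independent indX tA) centered_moment_le erefl y0
  (fun N => centered_majorant_egf_le N (introT andP (conj y0 y1)))
  (enum A) (fun=> 0%N) h.*2 (enum_uniq _).
rewrite -cardE big1// addn0 leqnn big1// mulr1.
have -> : (fun w => (\sum_(i <- enum A) centered i w) ^+ h.*2 * 1) =
    (fun w => (\sum_(i in A) centered i w) ^+ h.*2).
  by apply/funext => w; rewrite big_enum mulr1.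
move=> H; apply: le_trans (ler_norm _) (H _ _ _) => //.
by move=> i; rewrite mem_enum.
Qed.

End TwiseIndependentMoment.

(** * Colourings and the tail bound *)

Section SumInequalities.
Variables (R : realFieldType) (I : finType).
Implicit Types f g V : I -> R.

(** Chebyshev's sum inequality: the double sum of the hypotheses over i and j is
twice the difference of the two sides. *)
Lemma chebyshev_sum_le f g :
  (forall i j, 0 <= (f i - f j) * (g i - g j)) ->
  (\sum_i f i) * (\sum_i g i) <= #|I|%:R * \sum_i f i * g i.
Proof.
move=> fg; have : 0 <= \sum_i \sum_j (f i - f j) * (g i - g j).
  by apply: sumr_ge0 => i _; apply: sumr_ge0.
have -> : \sum_i \sum_j (f i - f j) * (g i - g j) =
    2 * (#|I|%:R * \sum_i f i * g i - (\sum_i f i) * (\sum_i g i)).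
  have cst x : \sum_(i : I) x = #|I|%:R * x :> R by rewrite sumr_const mulr_natl.
  pose S := \sum_i f i * g i.
  transitivity (\sum_i (#|I|%:R * (f i * g i) + S
                  - (f i * (\sum_j g j) + (\sum_j f j) * g i))).
    apply: eq_bigr => i _; rewrite -cst /S -big_split/= mulr_sumr mulr_suml.
    by rewrite -big_split/= -sumrB; apply: eq_bigr => j _; ring.
  rewrite sumrB !big_split/= -mulr_sumr -mulr_suml -mulr_sumr cst /S.
  by ring.
by rewrite pmulr_rge0// subr_ge0.
Qed.

Lemma sqr_sum_le f : (\sum_i f i) ^+ 2 <= #|I|%:R * \sum_i f i ^+ 2.
Proof.
under [in leRHS]eq_bigr do rewrite expr2.
by rewrite expr2 chebyshev_sum_le// => i j; rewrite -expr2 sqr_ge0.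
Qed.

Lemma power_mean_le V (h : nat) : (forall i, 0 <= V i) ->
  (\sum_i V i) ^+ h.+1 <= #|I|%:R ^+ h * \sum_i V i ^+ h.+1.
Proof.
move=> V0; elim: h => [|h IHh].
  by rewrite expr0 mul1r expr1 ler_sum.
rewrite exprSr (le_trans (ler_wpM2r _ IHh)) ?sumr_ge0//.
rewrite exprSr -!mulrA ler_wpM2l ?exprn_ge0//.
under [in leRHS]eq_bigr do rewrite exprSr.
apply: chebyshev_sum_le => i j.
have [Vij|/ltW Vji] := leP (V i) (V j).
  by rewrite mulr_le0 ?subr_le0 ?lerXn2r ?nnegrE.
by rewrite mulr_ge0 ?subr_ge0 ?lerXn2r ?nnegrE.
Qed.

End SumInequalities.

Section ColoredMoment.
Context {d : measure_display} {Omega : measurableType d} {R : realType}.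
Variables (P : probability Omega R) (I C : finType) (X : I -> {RV P >-> R}).
Hypothesis X01 : forall i w, 0 <= X i w <= 1.

Local Notation Ex f := (Rintegral P setT f).

(** Nothing relates variables of different classes.  Weighting each class by its
size, through a sum over vertices, gives all the vertices the same
moment bound and replaces the number of classes by #|I| in the power mean inequality;
#|C| enters once, through Cauchy-Schwarz. *)
Lemma colored_sum_moment_le (col : I -> C) (h : nat) : (0 < h)%N ->
  (forall c, twise_independent X h.*2 [set i | col i == c]%SET) ->
  Ex (fun w => (\sum_i centered X i w) ^+ h.*2)
  <= (#|I|%:R * h.*2%:R * #|C|%:R) ^+ h.
Proof.
case: h => // h _ indX; set t : R := h.+1.*2%:R.
pose A c := [set i | col i == c]%SET.
pose D c w := \sum_(i in A c) centered X i w.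
have bD c : bounded_rv (D c).
  by apply: bounded_rv_sum => i; exact: bounded_rv_centered.
pose V i w := D (col i) w ^+ 2 / #|A (col i)|%:R.
have V0 i w : 0 <= V i w by rewrite divr_ge0// sqr_ge0.
have bV i : bounded_rv (V i).
  by apply: bounded_rvM; [exact: bounded_rvX|exact: bounded_rv_cst].
have A_gt0 i : 0 < #|A (col i)|%:R :> R.
  by rewrite ltr0n card_gt0; apply/finset.set0Pn; exists i; rewrite inE.
have momV i : Ex (fun w => V i w ^+ h.+1) <= t ^+ h.+1.
  have -> : (fun w => V i w ^+ h.+1) =
      (fun w => (#|A (col i)|%:R ^+ h.+1)^-1 * D (col i) w ^+ h.+1.*2).
    by apply/funext => w; rewrite exprMn exprVn -exprM mul2n mulrC.
  rewrite ExZ; last exact: bounded_rvX.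
  rewrite ler_pdivrMl ?exprn_gt0// -exprMn.
  exact: (centered_sum_moment_le X01 _ (indX _)).
have sumD w : \sum_i centered X i w = \sum_c D c w.
  rewrite (partition_big col xpredT)//=; apply: eq_bigr => c _.
  by apply: eq_bigl => i; rewrite inE.
have sumV w : \sum_c D c w ^+ 2 = \sum_i V i w.
  rewrite (partition_big col xpredT)//=; apply: eq_bigr => c _.
  transitivity (\sum_(i in A c) D c w ^+ 2 / #|A c|%:R); last first.
    by apply: eq_big => [i|i]; rewrite inE// /V => /eqP ->.
  rewrite sumr_const -[RHS]mulr_natr.
  (* an unused colour contributes an empty sum on both sides *)
  have [Ac0|Ac0] := eqVneq #|A c| 0%N; last by rewrite mulfVK// pnatr_eq0.
  rewrite /D (_ : A c = finset.set0) ?big_set0 ?expr0n ?mul0r//.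
  exact/cards0_eq.
have main w : (\sum_i centered X i w) ^+ h.+1.*2 <=
    #|C|%:R ^+ h.+1 * #|I|%:R ^+ h * \sum_i V i w ^+ h.+1.
  rewrite sumD -mul2n exprM -mulrA.
  apply: (@le_trans _ _ ((#|C|%:R * \sum_i V i w) ^+ h.+1)).
    rewrite lerXn2r ?nnegrE ?sqr_ge0 ?mulr_ge0 ?sumr_ge0// -sumV.
    exact: sqr_sum_le.
  by rewrite exprMn ler_wpM2l ?exprn_ge0// power_mean_le.
have bsum : bounded_rv (fun w => \sum_i V i w ^+ h.+1).
  by apply: bounded_rv_sum => i; exact: bounded_rvX.
apply: (le_trans (le_Ex _ _ _ main)).
- by apply: bounded_rvX; apply: bounded_rv_sum => i; exact: bounded_rv_centered.
- by apply: bounded_rvM => //; exact: bounded_rv_cst.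
rewrite (ExZ P _ bsum) Ex_sum => [|i]; last exact: bounded_rvX.
apply: (@le_trans _ _ (#|C|%:R ^+ h.+1 * #|I|%:R ^+ h * \sum_(i : I) t ^+ h.+1)).
  by rewrite ler_wpM2l ?mulr_ge0 ?exprn_ge0// ler_sum.
rewrite sumr_const -[_ *+ #|_|]mulr_natr !exprMn [#|I|%:R ^+ h.+1]exprS.
by rewrite le_eqVlt; apply/orP; left; apply/eqP; ring.
Qed.

End ColoredMoment.

Lemma chromatic_coloring (n : nat) (G : sgraph n) :
  exists c : {ffun 'I_n -> 'I_(chromatic_number G)},
    forall i j, G i j -> c i != c j.
Proof.
rewrite /chromatic_number; case: ex_minnP => k /existsP[c /forallP cG] _.
by exists c => i j Gij; have /forallP/(_ j)/implyP/(_ Gij) := cG i.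
Qed.

Theorem theorem3p1 (d : measure_display) (Omega : measurableType d)
    (R : realType) (P : probability Omega R) (n t : nat) (G : sgraph n)
    (X : 'I_n -> {RV P >-> R})
    (hn : (0 < n)%N) (ht : (0 < t)%N) (ht_even : ~~ odd t)
    (hX01 : forall i w, 0 <= X i w <= 1)
    (hagree : t_agree t G X) (a : R) (ha : 0 < a) :
  let S : Omega -> R := fun w => \sum_(i < n) X i w in
  let mu : R := fine 'E_P[S] in
  (P [set w | a <= `|S w - mu|]%R <
   (2 * Num.sqrt (pi * t%:R) *
    (Num.sqrt (n%:R * t%:R * (chromatic_number G)%:R) / a) ^+ t)%R%:E)%E.
Proof.
cbv zeta; set S : Omega -> R := (X in ('E_P[X])%E); set mu := fine _.
have [c cG] := chromatic_coloring G.
have chi0 : (0 < chromatic_number G)%N.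
  exact: leq_ltn_trans (leq0n _) (ltn_ord (c (Ordinal hn))).
set chi := chromatic_number G in c cG chi0 *.
have tE : t = t./2.*2 by rewrite -[LHS]odd_double_half (negPf ht_even).
have h0 : (0 < t./2)%N by rewrite -double_gt0 -tE.
have Smu w : S w - mu = \sum_i centered X i w.
  rewrite /mu unlock -/(Rintegral P setT S) /S Ex_sum; last first.
    by move=> i; exact: bounded_rv_unit.
  by rewrite -sumrB.
have bS : bounded_rv (fun w => S w - mu).
  under eq_fun do rewrite Smu.
  by apply: bounded_rv_sum => i; exact: bounded_rv_centered.
have indX k : twise_independent X t./2.*2 [set i | c i == k]%SET.
  rewrite -tE; apply: hagree; apply/forallP => i; apply/implyP.
  rewrite inE => /eqP ci; apply/forallP => j; apply/implyP.
  by rewrite inE => /eqP cj; apply/negP => /cG; rewrite ci cj eqxx.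
have := colored_sum_moment_le hX01 h0 indX.
rewrite -tE !card_ord => moment.
have := markov_even_moment P t./2 bS ha; rewrite -tE.
move=> /le_lt_trans; apply; rewrite lte_fin.
under eq_fun do rewrite Smu.
set b : R := n%:R * t%:R * chi%:R in moment *.
have b0 : 0 < b by rewrite !mulr_gt0// ltr0n.
have sqrtb : Num.sqrt b ^+ t = b ^+ t./2.
  by rewrite {1}tE -mul2n exprM sqr_sqrtr// ltW.
rewrite expr_div_n sqrtb mulrA ltr_pM2r ?invr_gt0 ?exprn_gt0//.
apply: le_lt_trans moment _; rewrite ltr_pMl ?exprn_gt0//.
have t1 : 1 <= pi * t%:R :> R.
  have t1 : 1 <= t%:R :> R by rewrite ler1n.
  by have := pi_ge2 R; nra.
have : 1 <= Num.sqrt (pi * t%:R) :> R by rewrite -[leLHS]sqrtr1 ler_wsqrtr.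
lra.
Qed.
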